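(* Let $\beta: I\to M\subset G^3$ be a unit-speed curve on a surface $M$ in the Galilean space $G^3$ which is a line of curvature ($\tau_g\equiv0$), with geodesic curvature $\kappa_g$ and normal curvature $\kappa_n$. Then $\beta$ is an anti-Salkowski curve (its curvature $\kappa$ is not constant and its torsion $\tau$ is constant) if and only if $$\kappa_g''\kappa_g^2\kappa_n+\kappa_g''\kappa_n^3-\kappa_n''\kappa_g^3-\kappa_n''\kappa_g\kappa_n^2-2(\kappa_g')^2\kappa_g\kappa_n+2\kappa_g'\kappa_n'\kappa_g^2-2\kappa_g'\kappa_n'\kappa_n^2+2(\kappa_n')^2\kappa_g\kappa_n=0.$$
   Context: The Galilean space $G^3$ is $\mathbb R^3$ with the scalar product $\mathbf v\cdot_G\mathbf w=v_1w_1$ if $v_1\ne0$ or $w_1\neq 0$, and $\mathbf v\cdot_G\mathbf w=v_2w_2+v_3w_3$ if $v_1=w_1=0$; the norm is $\|\mathbf v\|_G=\sqrt{|\mathbf v\cdot_G\mathbf v|}$ and the cross product is $\mathbf v\times_G\mathbf w=(0,\,v_3w_1-v_1w_3,\,v_1w_2-v_2w_1)$. A unit-speed curve (parametrized by arc length) is one of the form $\beta(x)=(x,y(x),z(x))$, $x\in I\subset\mathbb R$. Its curvature is $\kappa=\|\beta''\|_G$, assumed positive, and its torsion is $\tau=\det(\beta',\beta'',\beta''')/\kappa^2$. $M$ is oriented; the Darboux frame of $\beta$ with respect to $M$ is $\{\mathbf T,\mathbf Q,\mathbf n\}$ with $\mathbf T=\beta'$, $\mathbf n$ the unit normal of $M$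 along $\beta$ (a vector field with first component $0$), and $\mathbf Q=\mathbf n\times_G\mathbf T$. The geodesic curvature $\kappa_g$, normal curvature $\kappa_n$ and geodesic torsion $\tau_g$ are the functions in $\mathbf T'=\kappa_g\mathbf Q+\kappa_n\mathbf n$, $\mathbf Q'=\tau_g\mathbf n$, $\mathbf n'=-\tau_g\mathbf Q$.
   Formalization: The formal theorem adds the hypothesis that the curvature κ is not constant; without it the claim fails, e.g. for β(x) = (x, x²/2, 0) on the plane z = 0, where the equation holds but κ = 1 is constant. *)

(* Defs.v *)
From Stdlib Require Import Reals.
From Coquelicot Require Import Coquelicot.
Open Scope R_scope.

(** * Galilean space *)

Definition G3 : Type := (R * R * R)%type.

Definition c1 (v : G3) : R := fst (fst v).
Definition c2 (v : G3) : R := snd (fst v).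
Definition c3 (v : G3) : R := snd v.

Definition gdot (v w : G3) : R :=
  if Req_EM_T (c1 v) 0 then
    if Req_EM_T (c1 w) 0 then c2 v * c2 w + c3 v * c3 w
    else c1 v * c1 w
  else c1 v * c1 w.

Definition gnorm (v : G3) : R := sqrt (Rabs (gdot v v)).

Definition gcross (v w : G3) : G3 :=
  (0, c3 v * c1 w - c1 v * c3 w, c1 v * c2 w - c2 v * c1 w).

Definition det3 (u v w : G3) : R :=
  c1 u * (c2 v * c3 w - c3 v * c2 w)
  - c2 u * (c1 v * c3 w - c3 v * c1 w)
  + c3 u * (c1 v * c2 w - c2 v * c1 w).

(** * Curves *)

Definition is_open_interval (I : R -> Prop) : Prop :=
  open I /\ (exists x, I x) /\
  (forall x y t, I x -> I y -> x <= t <= y -> I t).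

Definition smooth_curve (I : R -> Prop) (f : R -> G3) : Prop :=
  forall (n : nat) (x : R), I x ->
    ex_derive_n (fun t => c1 (f t)) n x /\
    ex_derive_n (fun t => c2 (f t)) n x /\
    ex_derive_n (fun t => c3 (f t)) n x.

(* [Derive_n] is total, so this is only meaningful where [f] is [n] times
   differentiable. *)
Definition vderive_n (f : R -> G3) (n : nat) (x : R) : G3 :=
  (Derive_n (fun t => c1 (f t)) n x,
   Derive_n (fun t => c2 (f t)) n x,
   Derive_n (fun t => c3 (f t)) n x).

Definition unit_speed (I : R -> Prop) (beta : R -> G3) : Prop :=
  forall x, I x -> c1 (beta x) = x.

Definition curvature (beta : R -> G3) (x : R) : R :=
  gnorm (vderive_n beta 2 x).

Definition torsion (beta : R -> G3) (x : R) : R :=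
  det3 (vderive_n beta 1 x) (vderive_n beta 2 x) (vderive_n beta 3 x)
  / (curvature beta x) ^ 2.

Definition constant_on (I : R -> Prop) (f : R -> R) : Prop :=
  exists c : R, forall x, I x -> f x = c.

Definition anti_salkowski (I : R -> Prop) (beta : R -> G3) : Prop :=
  ~ constant_on I (curvature beta) /\ constant_on I (torsion beta).

(** * Surfaces *)

Definition smooth_2d (U : R * R -> Prop) (f : R -> R -> R) : Prop :=
  forall (n : nat) (u v : R), U (u, v) -> ex_diff_n f n u v.

Definition partial_u (X : R -> R -> G3) (u v : R) : G3 :=
  vderive_n (fun t => X t v) 1 u.
Definition partial_v (X : R -> R -> G3) (u v : R) : G3 :=
  vderive_n (fun t => X u t) 1 v.

Definition lin_indep2 (v w : G3) : Prop :=
  forall r s : R,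
    (plus (scal r v) (scal s w) : G3) = (0, 0, 0) -> r = 0 /\ s = 0.

Definition regular_patch (U : R * R -> Prop) (X : R -> R -> G3) : Prop :=
  open U /\
  smooth_2d U (fun u v => c1 (X u v)) /\
  smooth_2d U (fun u v => c2 (X u v)) /\
  smooth_2d U (fun u v => c3 (X u v)) /\
  (forall u v, U (u, v) -> lin_indep2 (partial_u X u v) (partial_v X u v)).

(* Regular surface in the sense of do Carmo: every point has a neighbourhood
   [V] such that [X : U -> V /\ M] is a homeomorphism (with inverse [g]) and a
   smooth immersion. *)
Definition regular_surface (M : G3 -> Prop) : Prop :=
  forall p : G3, M p ->
    exists (V : G3 -> Prop) (U : R * R -> Prop) (X : R -> R -> G3)
           (g : G3 -> R * R),
      open V /\ V p /\ regular_patch U X /\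
      (forall u v, U (u, v) -> M (X u v) /\ V (X u v) /\ g (X u v) = (u, v)) /\
      (forall q, M q -> V q -> U (g q) /\ X (fst (g q)) (snd (g q)) = q) /\
      continuous_on (fun q => M q /\ V q) g.

Definition tangent (M : G3 -> Prop) (p w : G3) : Prop :=
  exists (eps : posreal) (gamma : R -> G3),
    smooth_curve (fun t => Rabs t < eps) gamma /\
    (forall t, Rabs t < eps -> M (gamma t)) /\
    gamma 0 = p /\ vderive_n gamma 1 0 = w.

(* Orientation by a continuous Galilean unit normal field.  In the Galilean
   setting a normal has first component [0] and is orthogonal to the isotropic
   tangent vectors only (those with first component [0]); the existence of a
   unit one forces every tangent plane to be different from the plane
   [x = const], i.e. [M] to be admissible.  A continuous unit normal of a
   smooth surface is automatically smooth. *)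
Definition unit_normal_field (M : G3 -> Prop) (N : G3 -> G3) : Prop :=
  continuous_on M N /\
  forall p, M p ->
    c1 (N p) = 0 /\ gnorm (N p) = 1 /\
    (forall w, tangent M p w -> c1 w = 0 -> gdot (N p) w = 0).

Definition oriented_surface (M : G3 -> Prop) (N : G3 -> G3) : Prop :=
  regular_surface M /\ unit_normal_field M N.

(** * Darboux frame *)

Definition frame_T (beta : R -> G3) (x : R) : G3 := vderive_n beta 1 x.

Definition frame_n (N : G3 -> G3) (beta : R -> G3) (x : R) : G3 := N (beta x).

Definition frame_Q (N : G3 -> G3) (beta : R -> G3) (x : R) : G3 :=
  gcross (frame_n N beta x) (frame_T beta x).

(* [kg], [kn], [tg] are the geodesic curvature, the normal curvature and the
   geodesic torsion on [I].  [Q] and [n] are linearly independent, so these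
   equations determine the three functions on [I]. *)
Definition darboux_functions (I : R -> Prop) (N : G3 -> G3) (beta : R -> G3)
    (kg kn tg : R -> R) : Prop :=
  forall x, I x ->
    is_derive (frame_T beta) x
      (plus (scal (kg x) (frame_Q N beta x)) (scal (kn x) (frame_n N beta x))) /\
    is_derive (frame_Q N beta) x (scal (tg x) (frame_n N beta x)) /\
    is_derive (frame_n N beta) x (scal (- tg x) (frame_Q N beta x)).

Definition line_of_curvature (I : R -> Prop) (tg : R -> R) : Prop :=
  forall x, I x -> tg x = 0.

(* Main.v *)
(** If [tg = 0] then [n] is a constant vector [(0, a, b)], and so is
    [Q = (0, b, -a)].  Hence [(kg, kn)] is obtained from [(y'', z'')] by a
    constant rotation, which gives
    [torsion = (kg kn' - kn kg') / (kg^2 + kn^2)]; the differential equation says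
    that the numerator of the derivative of this quotient vanishes. *)
From Pilot Require Import Defs.
From Stdlib Require Import Reals Lra.
From Coquelicot Require Import Coquelicot.
(* Again, because Stdlib's [Reals] shadows [c1]. *)
Import Pilot.Defs.
Open Scope R_scope.

Lemma is_derive_fst {U V : NormedModule R_AbsRing} (f : R -> U * V) (x : R) l :
  is_derive f x l -> is_derive (fun t => fst (f t)) x (fst l).
Proof.
  intros H.
  apply (filterdiff_comp' f fst x (fun y => scal y l) fst); [exact H|].
  exact (filterdiff_linear _ is_linear_fst).
Qed.

Lemma is_derive_snd {U V : NormedModule R_AbsRing} (f : R -> U * V) (x : R) l :
  is_derive f x l -> is_derive (fun t => snd (f t)) x (snd l).
Proof.
  intros H.
  apply (filterdiff_comp' f snd x (fun y => scal y l) snd); [exact H|].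
  exact (filterdiff_linear _ is_linear_snd).
Qed.

(** The values lie in an arbitrary normed module because the lemma serves real functions as well as
    the [G3]-valued normal. *)
Lemma derive_zero_constant {V : NormedModule R_AbsRing} (I : R -> Prop) (f : R -> V) :
  is_open_interval I -> (forall x, I x -> is_derive f x zero) ->
  forall x y, I x -> I y -> f x = f y.
Proof.
  intros (_ & _ & Hconv) Hf.
  assert (Hlt : forall x y, I x -> I y -> x < y -> f x = f y).
  { intros x y Hx Hy Hxy; apply eq_is_derive; [|exact Hxy].
    intros t Ht; apply Hf, (Hconv x y); assumption. }
  intros x y Hx Hy.
  destruct (Rtotal_order x y) as [H|[->|H]].
  - now apply Hlt.
  - reflexivity.
  - symmetry; now apply Hlt.
Qed.

Lemma constant_on_iff_derive (I : R -> Prop) (f df : R -> R) :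
  is_open_interval I -> (forall x, I x -> is_derive f x (df x)) ->
  constant_on I f <-> (forall x, I x -> df x = 0).
Proof.
  intros HI Hf; split.
  - intros [c Hc] x Hx.
    rewrite <- (is_derive_unique _ _ _ (Hf x Hx)), <- (Derive_const c x).
    apply Derive_ext_loc, (filter_imp I); [exact Hc|].
    now apply HI.
  - intros H0.
    pose proof HI as (_ & [x0 Hx0] & _).
    exists (f x0); intros x Hx.
    apply (derive_zero_constant I); trivial.
    intros t Ht; generalize (Hf t Ht); rewrite (H0 t Ht); trivial.
Qed.

Lemma constant_on_ext (I : R -> Prop) (f g : R -> R) :
  (forall x, I x -> f x = g x) -> constant_on I f <-> constant_on I g.
Proof.
  intros H; split; intros [c Hc]; exists c; intros x Hx;
    [rewrite <- H | rewrite H]; auto.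
Qed.

Lemma gnorm_sqr_isotropic (v : G3) : c1 v = 0 -> gnorm v ^ 2 = c2 v ^ 2 + c3 v ^ 2.
Proof.
  intros Hv; unfold gnorm, gdot.
  destruct (Req_EM_T (c1 v) 0) as [_|]; [|contradiction].
  rewrite pow2_sqrt by apply Rabs_pos.
  rewrite Rabs_pos_eq by nra; ring.
Qed.

(** The first coordinate is the identity only on [I]. Openness of [I] makes this an identity near
    [x], which is what differentiation needs; the next two lemmas repeat the argument. *)
Lemma unit_speed_derive1 (I : R -> Prop) (beta : R -> G3) (x : R) :
  open I -> unit_speed I beta -> I x -> c1 (vderive_n beta 1 x) = 1.
Proof.
  intros HI Hb Hx; change (Derive (fun t => c1 (beta t)) x = 1).
  rewrite <- (Derive_id x).
  apply Derive_ext_loc, (filter_imp I); [exact Hb|]; auto.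
Qed.

Lemma unit_speed_derive2 (I : R -> Prop) (beta : R -> G3) (x : R) :
  open I -> unit_speed I beta -> I x -> c1 (vderive_n beta 2 x) = 0.
Proof.
  intros HI Hb Hx; change (Derive (Derive (fun t => c1 (beta t))) x = 0).
  rewrite <- (Derive_const 1 x).
  apply Derive_ext_loc, (filter_imp I); [|now apply HI].
  intros t Ht; now apply (unit_speed_derive1 I).
Qed.

Lemma unit_speed_derive3 (I : R -> Prop) (beta : R -> G3) (x : R) :
  open I -> unit_speed I beta -> I x -> c1 (vderive_n beta 3 x) = 0.
Proof.
  intros HI Hb Hx.
  change (Derive (fun t => c1 (vderive_n beta 2 t)) x = 0).
  rewrite <- (Derive_const 0 x).
  apply Derive_ext_loc, (filter_imp I); [|now apply HI].
  intros t Ht; now apply (unit_speed_derive2 I).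
Qed.

Lemma unit_speed_curvature_sqr (I : R -> Prop) (beta : R -> G3) (x : R) :
  open I -> unit_speed I beta -> I x ->
  curvature beta x ^ 2 = c2 (vderive_n beta 2 x) ^ 2 + c3 (vderive_n beta 2 x) ^ 2.
Proof.
  intros HI Hb Hx; apply gnorm_sqr_isotropic; now apply (unit_speed_derive2 I).
Qed.

(** The first components of the three derivatives are 1, 0, 0, so the determinant collapses to a 2
    by 2 minor: the Wronskian of y'' and z''. *)
Lemma unit_speed_torsion (I : R -> Prop) (beta : R -> G3) (x : R) :
  open I -> unit_speed I beta -> I x ->
  torsion beta x =
  (c2 (vderive_n beta 2 x) * c3 (vderive_n beta 3 x)
   - c3 (vderive_n beta 2 x) * c2 (vderive_n beta 3 x))
  / (c2 (vderive_n beta 2 x) ^ 2 + c3 (vderive_n beta 2 x) ^ 2).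
Proof.
  intros HI Hb Hx; unfold torsion.
  rewrite (unit_speed_curvature_sqr I) by assumption.
  unfold det3.
  rewrite (unit_speed_derive1 I), (unit_speed_derive2 I), (unit_speed_derive3 I)
    by assumption.
  unfold Rdiv; ring.
Qed.

(** Quotient rule, where the f' g' terms cancel in (f g' - g f')' = f g'' - g f''. With [f] = [kg]
    and [g] = [kn] the numerator is minus the left-hand side of the differential equation. *)
Lemma is_derive_wronskian_quotient (f g : R -> R) (x : R) :
  ex_derive f x -> ex_derive g x -> ex_derive (Derive f) x -> ex_derive (Derive g) x ->
  f x ^ 2 + g x ^ 2 <> 0 ->
  is_derive (fun t => (f t * Derive g t - g t * Derive f t) / (f t ^ 2 + g t ^ 2)) x
    (- (Derive_n f 2 x * f x ^ 2 * g x
     + Derive_n f 2 x * g x ^ 3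
     - Derive_n g 2 x * f x ^ 3
     - Derive_n g 2 x * f x * g x ^ 2
     - 2 * (Derive f x) ^ 2 * f x * g x
     + 2 * Derive f x * Derive g x * f x ^ 2
     - 2 * Derive f x * Derive g x * g x ^ 2
     + 2 * (Derive g x) ^ 2 * f x * g x) / (f x ^ 2 + g x ^ 2) ^ 2).
Proof.
  intros Hf Hg Hf1 Hg1 Hne.
  change (Derive_n f 2 x) with (Derive (Derive f) x).
  change (Derive_n g 2 x) with (Derive (Derive g) x).
  generalize (Derive_correct _ _ Hf) (Derive_correct _ _ Hg)
    (Derive_correct _ _ Hf1) (Derive_correct _ _ Hg1).
  generalize (Derive (Derive f) x) (Derive (Derive g) x).
  set (f' := Derive f) in *; set (g' := Derive g) in *.
  intros f2 g2 Df Dg Df1 Dg1.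
  auto_derive.
  - repeat split; auto; simpl in Hne; lra.
  - change (Derive (fun t => f t)) with f'; change (Derive (fun t => g t)) with g'.
    change (Derive (fun t => f' t)) with (Derive f').
    change (Derive (fun t => g' t)) with (Derive g').
    rewrite (is_derive_unique _ _ _ Df1), (is_derive_unique _ _ _ Dg1).
    field; simpl in Hne; lra.
Qed.

Lemma line_of_curvature_normal_constant (I : R -> Prop) (N : G3 -> G3) (beta : R -> G3)
    (kg kn tg : R -> R) :
  is_open_interval I -> darboux_functions I N beta kg kn tg -> line_of_curvature I tg ->
  forall x y, I x -> I y -> frame_n N beta x = frame_n N beta y.
Proof.
  intros HI HD HL; apply derive_zero_constant; [exact HI|].
  intros x Hx; destruct (HD x Hx) as (_ & _ & Hn).
  rewrite (HL x Hx), Ropp_0 in Hn.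
  (* The explicit [eq_ind] matches the real number 0 with the [zero] of the scalar ring up to
     conversion. *)
  exact (eq_ind _ (is_derive (frame_n N beta) x) Hn _ (scal_zero_l (frame_Q N beta x))).
Qed.

(** These are the coordinates of T' = kg Q + kn n. As T has first component 1 and n has 0, Q is n
    turned by a right angle in the isotropic plane. *)
Lemma darboux_second_derivative (I : R -> Prop) (N : G3 -> G3) (beta : R -> G3)
    (kg kn tg : R -> R) (x : R) :
  open I -> unit_speed I beta -> darboux_functions I N beta kg kn tg ->
  I x -> c1 (frame_n N beta x) = 0 ->
  c2 (vderive_n beta 2 x) = kg x * c3 (frame_n N beta x) + kn x * c2 (frame_n N beta x) /\
  c3 (vderive_n beta 2 x) = - kg x * c2 (frame_n N beta x) + kn x * c3 (frame_n N beta x).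
Proof.
  intros HI Hb HD Hx Hn1.
  destruct (HD x Hx) as (HT & _ & _).
  pose proof (unit_speed_derive1 I beta x HI Hb Hx) as HT1.
  assert (HQ : frame_Q N beta x = (0, c3 (frame_n N beta x), - c2 (frame_n N beta x))).
  { unfold frame_Q, gcross, frame_T; rewrite HT1, Hn1; repeat f_equal; ring. }
  rewrite HQ in HT.
  split.
  - pose proof (is_derive_snd _ _ _ (is_derive_fst _ _ _ HT)) as H.
    exact (is_derive_unique _ _ _ H).
  - pose proof (is_derive_snd _ _ _ HT) as H.
    transitivity (kg x * - c2 (frame_n N beta x) + kn x * c3 (frame_n N beta x));
      [exact (is_derive_unique _ _ _ H) | ring].
Qed.

Theorem corollary4p16 (I : R -> Prop) (M : G3 -> Prop) (N : G3 -> G3)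
    (beta : R -> G3) (kg kn tg : R -> R)
    (hI : is_open_interval I)
    (hM : oriented_surface M N)
    (hsmooth : smooth_curve I beta)
    (hunit : unit_speed I beta)
    (hbetaM : forall x, I x -> M (beta x))
    (hcurv : forall x, I x -> 0 < curvature beta x)
    (hdarboux : darboux_functions I N beta kg kn tg)
    (hline : line_of_curvature I tg)
    (hnonconst : ~ constant_on I (curvature beta)) :
  anti_salkowski I beta <->
  (forall x, I x ->
     Derive_n kg 2 x * kg x ^ 2 * kn x
     + Derive_n kg 2 x * kn x ^ 3
     - Derive_n kn 2 x * kg x ^ 3
     - Derive_n kn 2 x * kg x * kn x ^ 2
     - 2 * (Derive kg x) ^ 2 * kg x * kn x
     + 2 * Derive kg x * Derive kn x * kg x ^ 2
     - 2 * Derive kg x * Derive kn x * kn x ^ 2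
     + 2 * (Derive kn x) ^ 2 * kg x * kn x = 0).
Proof.
  pose proof hI as (HIo & [x0 Hx0] & _).
  destruct hM as (_ & _ & HN).
  destruct (HN _ (hbetaM x0 Hx0)) as (Hn1 & Hnu & _).
  change (N (beta x0)) with (frame_n N beta x0) in Hn1, Hnu.
  pose proof (gnorm_sqr_isotropic _ Hn1) as Hab.
  rewrite Hnu in Hab.
  (* The normal is constant along the curve, so its coordinates at the single point [x0] serve on
     all of [I]. [Hab] now reads [1 ^ 2 = a ^ 2 + b ^ 2], which makes the matrix with rows (b, -a)
     and (a, b) a rotation. *)
  set (a := c2 (frame_n N beta x0)) in *; set (b := c3 (frame_n N beta x0)) in *.
  set (p := fun x => c2 (vderive_n beta 2 x)); set (q := fun x => c3 (vderive_n beta 2 x)).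
  assert (Hpq : forall x, I x ->
    p x = kg x * b + kn x * a /\ q x = - kg x * a + kn x * b).
  { intros x Hx.
    pose proof (line_of_curvature_normal_constant I N beta kg kn tg hI hdarboux hline
      x x0 Hx Hx0) as En.
    pose proof (darboux_second_derivative I N beta kg kn tg x HIo hunit hdarboux Hx) as H.
    rewrite En in H; exact (H Hn1). }
  (* Inverting the rotation expresses [kg] and [kn] through [p] and [q]; their differentiability is
     then inherited from the smoothness of [beta]. *)
  assert (Hkg : forall x, I x -> b * p x - a * q x = kg x).
  { intros x Hx; destruct (Hpq x Hx) as [-> ->].
    transitivity (kg x * (a ^ 2 + b ^ 2)); [ring | rewrite <- Hab; ring]. }
  assert (Hkn : forall x, I x -> a * p x + b * q x = kn x).
  { intros x Hx; destruct (Hpq x Hx) as [-> ->].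
    transitivity (kn x * (a ^ 2 + b ^ 2)); [ring | rewrite <- Hab; ring]. }
  (* [p] and [q] are already second derivatives, so differentiating them once or twice uses orders 3
     and 4 of [beta]. *)
  assert (Hp1 : forall x, I x -> ex_derive p x) by (intros x Hx; apply (hsmooth 3%nat x Hx)).
  assert (Hq1 : forall x, I x -> ex_derive q x) by (intros x Hx; apply (hsmooth 3%nat x Hx)).
  assert (Hp2 : forall x, I x -> ex_derive (Derive p) x)
    by (intros x Hx; apply (hsmooth 4%nat x Hx)).
  assert (Hq2 : forall x, I x -> ex_derive (Derive q) x)
    by (intros x Hx; apply (hsmooth 4%nat x Hx)).
  assert (Dkg : forall x, I x -> is_derive kg x (b * Derive p x - a * Derive q x)).
  { intros x Hx; apply (is_derive_ext_loc (fun t => b * p t - a * q t)).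
    - apply (filter_imp I); [exact Hkg | now apply HIo].
    - auto_derive; [now auto|].
      change (Derive (fun t => p t)) with (Derive p).
      change (Derive (fun t => q t)) with (Derive q); ring. }
  assert (Dkn : forall x, I x -> is_derive kn x (a * Derive p x + b * Derive q x)).
  { intros x Hx; apply (is_derive_ext_loc (fun t => a * p t + b * q t)).
    - apply (filter_imp I); [exact Hkn | now apply HIo].
    - auto_derive; [now auto|].
      change (Derive (fun t => p t)) with (Derive p).
      change (Derive (fun t => q t)) with (Derive q); ring. }
  assert (Hkg2 : forall x, I x -> ex_derive (Derive kg) x).
  { intros x Hx; apply (ex_derive_ext_loc (fun t => b * Derive p t - a * Derive q t)).
    - apply (filter_imp I); [|now apply HIo].
      intros t Ht; symmetry; now apply is_derive_unique, Dkg.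
    - auto_derive; now auto. }
  assert (Hkn2 : forall x, I x -> ex_derive (Derive kn) x).
  { intros x Hx; apply (ex_derive_ext_loc (fun t => a * Derive p t + b * Derive q t)).
    - apply (filter_imp I); [|now apply HIo].
      intros t Ht; symmetry; now apply is_derive_unique, Dkn.
    - auto_derive; now auto. }
  assert (Hnorm : forall x, I x -> p x ^ 2 + q x ^ 2 = kg x ^ 2 + kn x ^ 2).
  { intros x Hx; destruct (Hpq x Hx) as [-> ->].
    transitivity ((kg x ^ 2 + kn x ^ 2) * (a ^ 2 + b ^ 2)); [ring | rewrite <- Hab; ring]. }
  (* The sum is the squared curvature, which is positive by [hcurv]. *)
  assert (Hne : forall x, I x -> kg x ^ 2 + kn x ^ 2 <> 0).
  { intros x Hx; rewrite <- (Hnorm x Hx).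
    unfold p, q; rewrite <- (unit_speed_curvature_sqr I) by assumption.
    apply pow_nonzero, Rgt_not_eq, (hcurv x Hx). }
  (* A constant rotation preserves the Wronskian, since its determinant [a ^ 2 + b ^ 2] is 1, and it
     preserves the sum of squares by [Hnorm]. *)
  assert (Htor : forall x, I x -> torsion beta x =
    (kg x * Derive kn x - kn x * Derive kg x) / (kg x ^ 2 + kn x ^ 2)).
  { intros x Hx; rewrite (unit_speed_torsion I) by assumption.
    change (c2 (vderive_n beta 2 x)) with (p x); change (c3 (vderive_n beta 2 x)) with (q x).
    change (c2 (vderive_n beta 3 x)) with (Derive p x).
    change (c3 (vderive_n beta 3 x)) with (Derive q x).
    rewrite (Hnorm x Hx); f_equal.
    rewrite (is_derive_unique _ _ _ (Dkg x Hx)), (is_derive_unique _ _ _ (Dkn x Hx)).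
    rewrite <- (Hkg x Hx), <- (Hkn x Hx).
    transitivity ((p x * Derive q x - q x * Derive p x) * (a ^ 2 + b ^ 2));
      [rewrite <- Hab; ring | ring]. }
  (* [hnonconst] supplies the curvature half of the definition, leaving only the constancy of the
     torsion. *)
  assert (Hconst : anti_salkowski I beta <-> constant_on I (torsion beta))
    by (unfold anti_salkowski; tauto).
  rewrite Hconst, (constant_on_ext I _ _ Htor), (constant_on_iff_derive I _ _ hI
    (fun x Hx => is_derive_wronskian_quotient kg kn x
       (ex_intro _ _ (Dkg x Hx)) (ex_intro _ _ (Dkn x Hx))
       (Hkg2 x Hx) (Hkn2 x Hx) (Hne x Hx))).
  (* The derivative of the torsion is a fraction with nonzero denominator, so it vanishes exactly
     when its numerator does. *)
  split; intros H x Hx; specialize (H x Hx); specialize (Hne x Hx).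
  - unfold Rdiv in H.
    apply Rmult_integral in H; destruct H as [H|H]; [lra|].
    exfalso; revert H; apply Rinv_neq_0_compat, pow_nonzero, Hne.
  - rewrite H; unfold Rdiv; ring.
Qed.
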